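(* Let $G$ be a connected Lie group acting smoothly, transitively and effectively on a manifold $M=G/H$, where $H$ is the stabilizer of a point. If $H$ is compact, connected and nontrivial, then $\mathrm{ord}(G/H)=1$.
   Context: Let $e\in M$ be a base point and $H=H_e$ its stabilizer in $G$. For $i\ge0$ let $j_i(h)^{e,e}$ be the $i$-jet at $e$ of the diffeomorphism of $M$ induced by $h\in H$; the map $h\mapsto j_i(h)^{e,e}$ is a homomorphism from $H$ to the Lie group of $i$-jets of local diffeomorphisms of $M$ fixing $e$ (trivial for $i=0$). The order $\mathrm{ord}(G/H)$ is the smallest integer $k\ge 0$ such that $h\mapsto j_k(h)^{e,e}$ is injective on $H$; such an integer exists since $G$ is connected and acts effectively, and it does not depend on $e$. *)

(* Defs.v *)
From HB Require Import structures.
From mathcomp Require Import all_boot all_order all_algebra.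
From mathcomp Require Import all_classical all_reals all_analysis.

Set Implicit Arguments.
Unset Strict Implicit.
Unset Printing Implicit Defensive.

Import Order.TTheory GRing.Theory Num.Theory.
Import numFieldNormedType.Exports.

Local Open Scope classical_set_scope.
Local Open Scope ring_scope.

(** [Ck_on k A f] is meant for [A] open and [V] finite-dimensional: it then
    says that [f] is of class C^k on [A]. *)
Fixpoint Ck_on (R : realType) (V W : normedModType R) (k : nat) (A : set V)
    (f : V -> W) : Prop :=
  match k with
  | 0 => forall x, A x -> {for x, continuous f}
  | k'.+1 => (forall x, A x -> differentiable f x) /\
             (forall v : V, Ck_on k' A (fun x => 'D_v f x))
  end.

Definition Cinf_on (R : realType) (V W : normedModType R) (A : set V)
    (f : V -> W) : Prop :=
  forall k, Ck_on k A f.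

(** [iter_derive [:: v1; ...; vk] f = 'D_v1 ('D_v2 (... ('D_vk f)))]. *)
Definition iter_derive (R : realType) (V W : normedModType R) (vs : seq V)
    (f : V -> W) : V -> W :=
  foldr (fun v (g : V -> W) x => 'D_v g x) f vs.

(** A chart is given by total functions: [chart_map] is only relevant on
    [chart_dom], and [chart_inv] only on the image of [chart_dom]. *)
Record chart (E X : Type) := Chart {
  chart_dom : set X;
  chart_map :> X -> E;
  chart_inv : E -> X
}.

Definition chart_im (E X : Type) (phi : chart E X) : set E :=
  phi @` chart_dom phi.

Definition is_chart (E X : topologicalType) (phi : chart E X) : Prop :=
  [/\ open (chart_dom phi),
      open (chart_im phi),
      forall x, chart_dom phi x -> chart_inv phi (phi x) = x,
      forall x, chart_dom phi x -> {for x, continuous phi} &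
      forall u, chart_im phi u -> {for u, continuous (chart_inv phi)}].

Definition prod_chart (E F X Y : Type) (phi : chart E X) (psi : chart F Y) :
    chart (E * F)%type (X * Y)%type :=
  Chart (chart_dom phi `*` chart_dom psi)
        (fun z => (phi z.1, psi z.2))
        (fun w => (chart_inv phi w.1, chart_inv psi w.2)).

Definition prod_atlas (E F X Y : Type) (A : set (chart E X))
    (B : set (chart F Y)) : set (chart (E * F)%type (X * Y)%type) :=
  [set chi | exists phi psi, [/\ A phi, B psi & chi = prod_chart phi psi]].

Definition in_charts (E F X Y : Type) (phi : chart E X) (psi : chart F Y)
    (f : X -> Y) : E -> F :=
  psi \o f \o chart_inv phi.

(** [O] is meant to be open; together with continuity this makes the sets on
    which the coordinate expressions are required to be smooth open. *)
Definition smooth_on (R : realType) (E F : normedModType R)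
    (X Y : topologicalType) (A : set (chart E X)) (B : set (chart F Y))
    (O : set X) (f : X -> Y) : Prop :=
  (forall x, O x -> {for x, continuous f}) /\
  (forall phi psi, A phi -> B psi ->
     Cinf_on (phi @` (O `&` chart_dom phi `&` f @^-1` chart_dom psi))
             (in_charts phi psi f)).

HB.mixin Record isSmoothManifold (R : realType) (n : nat) M
    of Topological M := {
  atlas : set (chart 'rV[R]_n M);
  atlas_chart : forall phi, atlas phi -> is_chart phi;
  atlas_cover : forall p : M, exists2 phi, atlas phi & chart_dom phi p;
  atlas_compatible : forall phi psi, atlas phi -> atlas psi ->
    Cinf_on (phi @` (chart_dom phi `&` chart_dom psi))
            (psi \o chart_inv phi);
  manifold_hausdorff : hausdorff_space M;
  manifold_second_countable : @second_countable M
}.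

#[short(type="smoothManifoldType")]
HB.structure Definition SmoothManifold (R : realType) (n : nat) :=
  {M of isSmoothManifold R n M & Topological M}.

Arguments atlas {R n} s.

HB.mixin Record isLieGroup (R : realType) (n : nat) G
    of Group G & SmoothManifold R n G := {
  mulg_smooth :
    smooth_on (prod_atlas (@atlas R n G) (@atlas R n G)) (@atlas R n G)
      setT (fun z : G * G => (z.1 * z.2)%g);
  invg_smooth :
    smooth_on (@atlas R n G) (@atlas R n G) setT (fun x : G => (x^-1)%g)
}.

#[short(type="lieGroupType")]
HB.structure Definition LieGroup (R : realType) (n : nat) :=
  {G of Group G & SmoothManifold R n G & isLieGroup R n G}.

Section Jets.
Context {R : realType} {m n : nat}.
Context {M : smoothManifoldType R m} {N : smoothManifoldType R n}.

Definition smooth_near (p : M) (f : M -> N) : Prop :=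
  exists O : set M, [/\ open O, O p & smooth_on (atlas M) (atlas N) O f].

(** Derivatives along all vectors, not only basis vectors, are compared. *)
Definition same_jet (k : nat) (p : M) (f g : M -> N) : Prop :=
  f p = g p /\
  forall phi psi, atlas M phi -> atlas N psi ->
    chart_dom phi p -> chart_dom psi (f p) ->
    forall vs : seq 'rV[R]_m, (size vs <= k)%N ->
      iter_derive vs (in_charts phi psi f) (phi p) =
      iter_derive vs (in_charts phi psi g) (phi p).

(** The [k]-jet of [f] at [p], as an equivalence class of maps smooth near
    [p]; only their germs at [p] matter, so total functions suffice. *)
Definition jet (k : nat) (p : M) (f : M -> N) : set (M -> N) :=
  [set g | smooth_near p g /\ same_jet k p f g].

End Jets.

Section Actions.
Context {R : realType} {d n : nat}.
Context {G : lieGroupType R d} {M : smoothManifoldType R n}.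
Variable act : G -> M -> M.

Definition smooth_action : Prop :=
  [/\ forall x, act 1%g x = x,
      forall g h x, act (g * h)%g x = act g (act h x) &
      smooth_on (prod_atlas (atlas G) (atlas M)) (atlas M) setT
        (fun z : G * M => act z.1 z.2)].

Definition transitive_action : Prop := forall x y, exists g, act g x = y.

Definition effective_action : Prop :=
  forall g, (forall x, act g x = x) -> g = 1%g.

Definition stabilizer (e : M) : set G := [set h | act h e = e].

Definition jet_faithful (e : M) (k : nat) : Prop :=
  {in stabilizer e &, injective (fun h => jet k e (act h))}.

(** The least [k] with [jet_faithful e k] (and [0] if there is none). *)
Definition action_order (e : M) : nat :=
  xget 0%N [set k | jet_faithful e k /\
                    forall i, jet_faithful e i -> (k <= i)%N].

End Actions.

(* Main.v *)
Require Import Defs.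
From mathcomp Require Import all_boot all_order all_algebra.
From mathcomp Require Import lra.
From mathcomp Require Import all_classical all_reals all_analysis.

(** Write [H_x] for the stabilizer of [x].  Two elements of [H_e] have the same
    0-jet at [e], so order [0] would force [H_e] to be trivial.  It remains to
    see that [h] in [H_e] is the identity as soon as its differential at [e]
    is; applied to [k^-1 * h] ([tangent_to_id_quotient]) this makes the 1-jet
    faithful.

    The usual argument makes [h] an isometry of an invariant Riemannian metric.
    Here compactness of the stabilizer is used directly.  In a chart around
    [x], the derivatives of all elements of [H_x] that are tangent to the
    identity at [x] stay uniformly close to the identity on one common ball,
    so the displacement [k u - u] of each such [k] varies by at most
    [`|u - v| / 2] between [u] and [v]: this is
    [tangent_to_id_uniformly_near_id].  Take for [k] the powers of [h] and for
    [u], [v] the points [h y] and [y], with [y] near [x].  Each step from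
    [h^m y] to [h^(m+1) y] then differs from the first step [h y - y] by at most
    half its length, so the orbit of [y] drifts linearly unless [h y = y].  The
    same estimate with [v = x] keeps that orbit bounded; hence [h] fixes every
    point near [x] ([tangent_to_id_locally_trivial]).

    Therefore the interior of the fixed point set of [h] is nonempty.  It is
    also closed: at a point [p] of its closure, [h] fixes [p] and, by continuity
    of the derivative, is tangent to the identity there, while [H_p] is
    conjugate to [H_e] and so compact, and the local result applies again.
    Since [M] is connected, as an orbit of [G], [h] acts trivially
    ([tangent_to_id_trivial]), and effectiveness gives [h = 1]. *)

Set Implicit Arguments.
Unset Strict Implicit.
Unset Printing Implicit Defensive.

Import Order.TTheory GRing.Theory Num.Theory.
Import numFieldNormedType.Exports.

Local Open Scope classical_set_scope.
Local Open Scope ring_scope.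

(** * Estimates from directional derivatives *)

Lemma derive_line {R : realType} {V W : normedModType R} (g : V -> W)
    (u w : V) (t : R) :
  'D_1 (fun s : R => g (s *: w + u)) t = 'D_w g (t *: w + u).
Proof.
rewrite /derive; set g1 := fun h => h^-1 *: _; set g2 := fun h => h^-1 *: _.
suff -> : g1 = g2 by [].
apply/funext => h; rewrite /g1 /g2 /=.
by rewrite [h *: 1]mulr1 scalerDl addrA.
Qed.

Lemma derivable_line {R : realType} {V W : normedModType R} (g : V -> W)
    (u w : V) (t : R) :
  derivable (fun s : R => g (s *: w + u)) t 1 = derivable g (t *: w + u) w.
Proof.
rewrite /derivable; set g1 := fun h => h^-1 *: _; set g2 := fun h => h^-1 *: _.
suff -> : g1 = g2 by [].
apply/funext => h; rewrite /g1 /g2 /=.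
by rewrite [h *: 1]mulr1 scalerDl addrA.
Qed.

Lemma coord_le_mx_norm {R : realType} {m n : nat} (x : 'M[R]_(m, n)) i j :
  `|x i j| <= `|x|.
Proof.
by rewrite [`|x|]mx_normrE (le_bigmax _ (fun ij => `|x ij.1 ij.2|) (i, j)).
Qed.

Lemma mx_norm_le {R : realType} {m n : nat} (x : 'M[R]_(m, n)) (C : R) :
  0 <= C -> (forall i j, `|x i j| <= C) -> `|x| <= C.
Proof.
move=> C0 xC; have [->|x0] := eqVneq x 0; first by rewrite normr0.
have : mx_norm x != 0 by rewrite -[mx_norm x]/(`|x|) normr_eq0.
by move=> /mx_norm_neq0[ij]; rewrite -[mx_norm x]/(`|x|) => ->.
Qed.

Lemma segment_ball {R : realType} {V : normedModType R} (c u v : V) (r t : R) :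
  ball c r u -> ball c r v -> t \in `[0, 1] -> ball c r (t *: (u - v) + v).
Proof.
rewrite -!ball_normE /ball_ /= in_itv /= => cu cv /andP[t0 t1].
have -> : c - (t *: (u - v) + v) = t *: (c - u) + (1 - t) *: (c - v).
  rewrite [in RHS]scalerBl scale1r addrCA -scalerBr opprB.
  by rewrite [c - u + _]addrC subrKA opprD addrCA addrC -scalerN opprB.
apply: (le_lt_trans (ler_normD _ _)); rewrite !normrZ (ger0_norm t0).
rewrite ger0_norm ?subr_ge0//.
have [->|t0'] := eqVneq t 0; first by rewrite mul0r add0r subr0 mul1r.
have -> : r = t * r + (1 - t) * r by rewrite -mulrDl addrC subrK mul1r.
apply: ltr_leD; first by rewrite ltr_pM2l// lt_neqAle eq_sym t0'.
by rewrite ler_wpM2l ?subr_ge0// ltW.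
Qed.

(** The mean value theorem holds for real functions only, hence it is applied to
    each entry of [g] along the segment from [v] to [u]; the max norm loses no
    constant. *)
Lemma lipschitz_on_ball {R : realType} {V : normedModType R} {m n : nat}
    (g : V -> 'M[R]_(m, n)) (c : V) (r C : R) :
  0 <= C ->
  (forall u, ball c r u -> differentiable g u) ->
  (forall u w, ball c r u -> `|'D_w g u| <= C * `|w|) ->
  forall u v, ball c r u -> ball c r v -> `|g u - g v| <= C * `|u - v|.
Proof.
move=> C0 dg Dg u v cu cv.
apply: mx_norm_le => [|i j]; first by rewrite mulr_ge0.
pose p (t : R) : R := g (t *: (u - v) + v) i j.
have dp (t : R) : t \in `[0, 1] ->
    is_derive t 1 p ('D_(u - v) g (t *: (u - v) + v) i j).
  move=> /(segment_ball cu cv) ct.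
  have dl := @diff_derivable _ _ _ _ _ (u - v) (dg _ ct).
  rewrite -derivable_line in dl.
  apply: DeriveDef; first by have /derivable_mxP := dl; apply.
  by have := derive_mx dl; rewrite derive_line => ->; rewrite mxE.
have [|t t01] := @MVT_segment _ p _ 0 1 ler01
    (fun t t01 => dp t (subset_itv_oo_cc t01)).
  by apply: derivable_within_continuous => t /dp [].
rewrite subr0 mulr1 /p scale0r add0r scale1r subrK !mxE => ->.
apply: (le_trans (coord_le_mx_norm _ _ _)).
exact/Dg/segment_ball.
Qed.

(** Partial derivatives are directional derivatives of the joint map; this lets
    joint smoothness of the action control the maps of single elements. *)
Lemma derive_pair_r {R : realType} {U V W : normedModType R}
    (F : U * V -> W) (a : U) (u v : V) :
  'D_v (fun y => F (a, y)) u = 'D_((0 : U), v) F (a, u).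
Proof.
rewrite /derive; set g1 := fun h => h^-1 *: _; set g2 := fun h => h^-1 *: _.
suff -> : g1 = g2 by [].
apply/funext => h; rewrite /g1 /g2 /=.
have -> // : h *: ((0 : U), v) + (a, u) = (a, h *: v + u).
by congr pair; rewrite /= scaler0 add0r.
Qed.

Lemma Ck_on_pair_r {R : realType} {U V W : normedModType R} (k : nat)
    (A : set (U * V)) (F : U * V -> W) (a : U) (B : set V) :
  (forall y, B y -> A (a, y)) -> Ck_on k A F ->
  Ck_on k B (fun y => F (a, y)).
Proof.
elim: k F => [|k IH] F BA /=.
  move=> FA y /BA /FA Fy.
  apply: (@continuous_comp _ _ _ (fun y => (a, y)) F) => //.
  by apply: cvg_pair; [exact: cvg_cst|exact: cvg_id].
move=> [dF DF]; split=> [y /BA /dF Fy|v].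
  by apply: (@differentiable_comp _ _ _ _ (fun y => (a, y)) F).
have -> : (fun x => 'D_v (fun y => F (a, y)) x) =
    (fun x => (fun z => 'D_((0 : U), v) F z) (a, x)).
  by apply/funext => y; rewrite derive_pair_r.
exact: (IH _ BA (DF _)).
Qed.

Lemma derive_rowE {R : realType} {n : nat} {W : normedModType R}
    (g : 'rV[R]_n -> W) (u w : 'rV[R]_n) :
  differentiable g u ->
  'D_w g u = \sum_j w 0 j *: 'D_(delta_mx 0 j) g u.
Proof.
move=> dg; rewrite deriveE// {1}(row_sum_delta w) linear_sum.
by apply: eq_bigr => j _; rewrite linearZ/= deriveE.
Qed.

Definition near_id_on {R : realType} {V : normedModType R} (f : V -> V)
    (c : V) (r : R) :=
  forall u v, ball c r u -> ball c r v ->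
    `|(f u - f v) - (u - v)| <= 2^-1 * `|u - v|.

(** Closeness on basis vectors suffices, at the price of the factor [n]. *)
Lemma near_id_on_ball {R : realType} {n : nat} (F : 'rV[R]_n -> 'rV[R]_n)
    (c : 'rV[R]_n) (r eps : R) :
  0 <= eps ->
  (forall u, ball c r u -> differentiable F u) ->
  (forall u j, ball c r u ->
     `|'D_(delta_mx 0 j) F u - delta_mx 0 j| <= eps) ->
  forall u v, ball c r u -> ball c r v ->
    `|(F u - F v) - (u - v)| <= n%:R * eps * `|u - v|.
Proof.
move=> eps0 dF DF u v cu cv.
have -> : F u - F v - (u - v) = (F \- id) u - (F \- id) v.
  by rewrite /= !opprB addrACA [in RHS]addrACA; congr (_ + _); rewrite addrC.
apply: (@lipschitz_on_ball R 'rV[R]_n 1 n (F \- id) c r (n%:R * eps)) => //.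
- by rewrite mulr_ge0.
- by move=> x cx; apply: differentiableB => //; exact: dF.
move=> x w cx.
rewrite deriveB; last 2 first.
- by apply: diff_derivable; exact: dF.
- exact: derivable_id.
rewrite derive_id derive_rowE; last exact: dF.
rewrite [in X in _ - X](row_sum_delta w) -sumrB.
apply: (le_trans (ler_norm_sum _ _ _)).
rewrite -mulrA mulr_natl -[X in _ *+ X]card_ord -sumr_const.
apply: ler_sum => j _; rewrite -scalerBr normrZ mulrC.
by apply: ler_pM => //; [exact: DF|exact: coord_le_mx_norm].
Qed.

(** A sequence whose steps all stay within [`|d| / 2] of [d] moves at least
    [m * `|d| / 2] in [m] steps. *)
Lemma bounded_drift_eq0 {R : realType} {V : normedModType R}
    (x : nat -> V) (c d : V) (B : R) :
  (forall n, `|x n.+1 - x n - d| <= 2^-1 * `|d|) ->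
  (forall n, `|x n - c| <= B) -> d = 0.
Proof.
move=> xd xB.
have drift n : `|x n - x 0%N - d *+ n| <= n%:R * (2^-1 * `|d|).
  elim: n => [|n IH]; first by rewrite subrr mulr0n subr0 normr0 mul0r.
  rewrite mulrSr opprD mulrS mulrDl mul1r.
  have -> : x n.+1 - x 0%N + (- (d *+ n) - d) =
      (x n.+1 - x n - d) + (x n - x 0%N - d *+ n).
    by rewrite [RHS]addrACA subrKA [- d - _]addrC.
  by apply: (le_trans (ler_normD _ _)); rewrite lerD.
have lin n : n%:R * `|d| <= 4%:R * B.
  have h := drift n.
  have dB : `|x n - x 0%N| <= B + B.
    rewrite -(subrKA c); apply: (le_trans (ler_normD _ _)).
    by rewrite lerD// distrC.
  have : `|d *+ n| <= `|x n - x 0%N| + n%:R * (2^-1 * `|d|).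
    rewrite -[d *+ n](subKr (x n - x 0%N)).
    apply: (le_trans (ler_normB _ _)); exact: lerD.
  rewrite normrMn -mulr_natl => h2; nra.
apply/eqP; rewrite -normr_le0 leNgt; apply/negP => d0.
have := lin (Num.bound `|4%:R * B / `|d| |).
rewrite -ler_pdivlMr// leNgt => /negP; apply.
by rewrite (le_lt_trans (ler_norm _))// archi_boundP.
Qed.

(** * Neighbourhoods in charts *)

Section Charts.
Context {R : realType} {n : nat} {M : smoothManifoldType R n}.
Variable phi : chart 'rV[R]_n M.
Hypothesis phiA : atlas M phi.

Lemma chart_invK y : chart_dom phi y -> chart_inv phi (phi y) = y.
Proof. by have [_ _ K _ _] := atlas_chart _ phiA; exact: K. Qed.

Lemma near_chart_dom y : chart_dom phi y -> \forall z \near y, chart_dom phi z.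
Proof.
have [oD _ _ _ _] := atlas_chart _ phiA; move=> yd.
by apply: open_nbhs_nbhs; split.
Qed.

Lemma near_chart_im y : chart_dom phi y ->
  \forall u \near phi y,
    chart_dom phi (chart_inv phi u) /\ phi (chart_inv phi u) = u.
Proof.
have [_ o K _ _] := atlas_chart _ phiA; move=> yd.
have : nbhs (phi y) (chart_im phi).
  by apply: open_nbhs_nbhs; split => //; exists y.
by apply: filterS => u [z zd <-]; rewrite K.
Qed.

Lemma chart_continuous y : chart_dom phi y -> {for y, continuous phi}.
Proof. by have [_ _ _ c _] := atlas_chart _ phiA; exact: c. Qed.

Lemma near_chart_inv y (P : set M) : chart_dom phi y ->
  (\forall z \near y, P z) -> \forall u \near phi y, P (chart_inv phi u).
Proof.
have [_ _ K _ c] := atlas_chart _ phiA; move=> yd Py.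
have yi : chart_im phi (phi y) by exists y.
have cy : chart_inv phi @ phi y --> chart_inv phi (phi y) := c _ yi.
rewrite (K _ yd) in cy.
exact: (cy _ Py).
Qed.

End Charts.

(** * The action and its coordinate expressions *)

Section Action.
Context {R : realType} {d n : nat}.
Context {G : lieGroupType R d} {M : smoothManifoldType R n}.
Variable act : G -> M -> M.
Hypothesis actS : smooth_action act.

Lemma act1 x : act 1%g x = x.
Proof. by have [h _ _] := actS; exact: h. Qed.

Lemma actM g h x : act (g * h)%g x = act g (act h x).
Proof. by have [_ h' _] := actS; exact: h'. Qed.

Lemma actK g : cancel (act g) (act g^-1%g).
Proof. by move=> x; rewrite -actM mulVg act1. Qed.

Lemma act_continuous2 : continuous (fun z : G * M => act z.1 z.2).
Proof. by have [_ _ [h _]] := actS; move=> z; exact: h. Qed.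

Lemma act_continuous g : continuous (act g).
Proof.
move=> x; apply: (@continuous_comp M (G * M)%type M (fun y => (g, y))
  (fun z => act z.1 z.2)).
  by apply: cvg_pair; [exact: cvg_cst|exact: cvg_id].
exact: act_continuous2.
Qed.

Lemma orbit_map_continuous x : continuous (act^~ x).
Proof.
move=> g; apply: (@continuous_comp G (G * M)%type M (fun k => (k, x))
  (fun z => act z.1 z.2)).
  by apply: cvg_pair; [exact: cvg_id|exact: cvg_cst].
exact: act_continuous2.
Qed.

Lemma mull_continuous (g : G) : continuous (fun k : G => (g * k)%g).
Proof.
have [h _] := @mulg_smooth R d G.
move=> k; apply: (@continuous_comp G (G * G)%type G (fun k => (g, k))
  (fun z => z.1 * z.2)%g).
  by apply: cvg_pair; [exact: cvg_cst|exact: cvg_id].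
exact: h.
Qed.

Lemma mulr_continuous (g : G) : continuous (fun k : G => (k * g)%g).
Proof.
have [h _] := @mulg_smooth R d G.
move=> k; apply: (@continuous_comp G (G * G)%type G (fun k => (k, g))
  (fun z => z.1 * z.2)%g).
  by apply: cvg_pair; [exact: cvg_id|exact: cvg_cst].
exact: h.
Qed.

(** The stabilizer of [act g x] is the conjugate by [g] of that of [x]. *)
Lemma compact_stabilizer_act g x :
  compact (stabilizer act x) -> compact (stabilizer act (act g x)).
Proof.
move=> Kx.
have -> : stabilizer act (act g x) =
    (fun k => (g * k) * g^-1)%g @` stabilizer act x.
  apply/seteqP; split=> [h hx|_ [k kx <-]].
    exists (g^-1 * h * g)%g; last by rewrite !mulgA mulgV mul1g mulgK.
    by rewrite /stabilizer /= !actM hx actK.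
  by rewrite /stabilizer /= !actM actK kx.
apply: continuous_compact => //; apply: continuous_subspaceT => k.
apply: (@continuous_comp G G G (fun k => g * k)%g (fun k => k * g^-1)%g).
  exact: mull_continuous.
exact: mulr_continuous.
Qed.

Lemma transitive_connected :
  connected [set: G] -> transitive_action act -> connected [set: M].
Proof.
move=> cG tr; have [[x _]|M0] := pselect (exists x : M, True); last first.
  by move=> B [x]; exfalso; apply: M0; exists x.
have -> : [set: M] = act^~ x @` [set: G].
  by apply/seteqP; split=> // y _; have [g <-] := tr x y; exists g.
apply: connected_continuous_connected => //.
exact/continuous_subspaceT/orbit_map_continuous.
Qed.

Definition act_charts (alpha : chart 'rV[R]_d G) (phi psi : chart 'rV[R]_n M) :
    'rV[R]_d * 'rV[R]_n -> 'rV[R]_n :=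
  in_charts (prod_chart alpha phi) psi (fun z : G * M => act z.1 z.2).

(** The set on which [smooth_on] asserts smoothness of [act_charts]. *)
Definition act_charts_dom (alpha : chart 'rV[R]_d G)
    (phi psi : chart 'rV[R]_n M) : set ('rV[R]_d * 'rV[R]_n) :=
  prod_chart alpha phi @` (setT `&` chart_dom (prod_chart alpha phi) `&`
    (fun z : G * M => act z.1 z.2) @^-1` chart_dom psi).

Lemma act_charts_smooth alpha phi psi :
  atlas G alpha -> atlas M phi -> atlas M psi ->
  Cinf_on (act_charts_dom alpha phi psi) (act_charts alpha phi psi).
Proof.
move=> aA pA qA; have [_ _ [_ h]] := actS.
by apply: h => //; exists alpha, phi.
Qed.

Lemma act_chartsE alpha phi psi k u : atlas G alpha -> chart_dom alpha k ->
  act_charts alpha phi psi (alpha k, u) = in_charts phi psi (act k) u.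
Proof.
by move=> aA kd; rewrite /act_charts /in_charts /= chart_invK.
Qed.

Lemma act_smooth_on k : smooth_on (atlas M) (atlas M) setT (act k).
Proof.
split=> [x _|phi psi pA qA m]; first exact: act_continuous.
have [alpha aA kd] := atlas_cover k.
have -> : in_charts phi psi (act k) =
    (fun u => act_charts alpha phi psi (alpha k, u)).
  by apply/funext => u; rewrite act_chartsE.
apply: Ck_on_pair_r; last exact: (act_charts_smooth aA pA qA).
by move=> _ [y [[_ yd] ky] <-]; exists (k, y).
Qed.

Lemma act_chart_differentiable phi psi k y : atlas M phi -> atlas M psi ->
  chart_dom phi y -> chart_dom psi (act k y) ->
  differentiable (in_charts phi psi (act k)) (phi y).
Proof.
move=> pA qA yd kyd; have [_ h] := act_smooth_on k.
by have /= [df _] := h _ _ pA qA 1%N; apply: df; exists y.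
Qed.

Lemma act_chart_derive_continuous phi psi k y w : atlas M phi -> atlas M psi ->
  chart_dom phi y -> chart_dom psi (act k y) ->
  {for phi y, continuous (fun u => 'D_w (in_charts phi psi (act k)) u)}.
Proof.
move=> pA qA yd kyd; have [_ h] := act_smooth_on k.
by have /= [_ Df] := h _ _ pA qA 1%N; apply: Df; exists y.
Qed.

(** Chain rule at a common fixed point, where both maps are read in the same
    chart. *)
Lemma derive_act_mul phi x k k' w : atlas M phi -> chart_dom phi x ->
  stabilizer act x k -> stabilizer act x k' ->
  'D_w (in_charts phi phi (act (k * k')%g)) (phi x) =
  'D_('D_w (in_charts phi phi (act k')) (phi x))
     (in_charts phi phi (act k)) (phi x).
Proof.
move=> pA xd kx k'x.
have k'xE : act k' x = x := k'x; have kxE : act k x = x := kx.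
have E : \forall u \near phi x, in_charts phi phi (act (k * k')%g) u =
    (in_charts phi phi (act k) \o in_charts phi phi (act k')) u.
  have : \forall y \near x, chart_dom phi (act k' y).
    apply: (@act_continuous k' x (chart_dom phi)).
    by rewrite k'xE; exact: near_chart_dom.
  move/(near_chart_inv pA xd); apply: filterS => u ud.
  by rewrite /in_charts /= chart_invK// actM.
have fixE : in_charts phi phi (act k') (phi x) = phi x.
  by rewrite /in_charts /= chart_invK// k'xE.
have dk' : differentiable (in_charts phi phi (act k')) (phi x).
  by apply: act_chart_differentiable => //; rewrite k'xE.
have dk : differentiable (in_charts phi phi (act k)) (phi x).
  by apply: act_chart_differentiable => //; rewrite kxE.
rewrite (near_eq_derive _ E) deriveE; last first.
  by apply: differentiable_comp => //; rewrite fixE.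
rewrite diff_comp//; last by rewrite fixE.
by rewrite /= fixE !deriveE.
Qed.

(** * Elements whose 1-jet is trivial *)

(** One chart suffices: triviality of the differential at a fixed point does not
    depend on the chart. *)
Definition tangent_to_id (phi : chart 'rV[R]_n M) x k :=
  act k x = x /\ forall w, 'D_w (in_charts phi phi (act k)) (phi x) = w.

Lemma tangent_to_id1 phi x : atlas M phi -> chart_dom phi x ->
  tangent_to_id phi x 1%g.
Proof.
move=> pA xd; split=> [|w]; first exact: act1.
have E : \forall u \near phi x, in_charts phi phi (act 1%g) u = id u.
  apply: filterS (near_chart_im pA xd) => u [ud uE].
  by rewrite /in_charts /= act1.
by rewrite (near_eq_derive _ E) derive_id.
Qed.

Lemma tangent_to_idX phi x k m : atlas M phi -> chart_dom phi x ->
  tangent_to_id phi x k -> tangent_to_id phi x (k ^+ m)%g.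
Proof.
move=> pA xd [kx kD]; elim: m => [|m [mx mD]]; first exact: tangent_to_id1.
split=> [|w]; first by rewrite expgS actM mx.
by rewrite expgS derive_act_mul// mD.
Qed.

Lemma tangent_to_id_quotient phi x h k : atlas M phi -> chart_dom phi x ->
  stabilizer act x h -> stabilizer act x k ->
  (forall w, 'D_w (in_charts phi phi (act h)) (phi x) =
             'D_w (in_charts phi phi (act k)) (phi x)) ->
  tangent_to_id phi x (k^-1 * h)%g.
Proof.
move=> pA xd hx kx D.
have k'x : stabilizer act x k^-1%g by rewrite /stabilizer /= -{1}kx actK.
split=> [|w]; first by rewrite actM hx k'x.
rewrite derive_act_mul// D -derive_act_mul// mulVg.
by have [_ ->] := tangent_to_id1 pA xd.
Qed.

Lemma near_act_charts_dom alpha phi k x : atlas G alpha -> atlas M phi ->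
  chart_dom alpha k -> chart_dom phi x -> stabilizer act x k ->
  \forall z \near (alpha k, phi x), act_charts_dom alpha phi phi z.
Proof.
move=> aA pA kd xd kx.
have : \forall z \near (k, x), chart_dom phi (act z.1 z.2).
  apply: (@act_continuous2 (k, x) (chart_dom phi)) => /=.
  by rewrite (_ : act k x = x)//; exact: near_chart_dom.
move=> [[P Q] /= [kP xQ] PQ].
have aP := near_chart_inv aA kd kP; have pQ := near_chart_inv pA xd xQ.
exists ([set a | (chart_dom alpha (chart_inv alpha a) /\
                  alpha (chart_inv alpha a) = a) /\ P (chart_inv alpha a)],
        [set u | (chart_dom phi (chart_inv phi u) /\
                  phi (chart_inv phi u) = u) /\ Q (chart_inv phi u)]) => /=.
  by split; apply: filterI => //; exact: near_chart_im.
move=> [a u] /= [[[ad aE] Pa] [[ud uE] Qu]].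
exists (chart_inv alpha a, chart_inv phi u) => /=; last by rewrite aE uE.
by split; [split|exact: (PQ (_, _))].
Qed.

(** * Rigidity of elements tangent to the identity *)

(** Only elements tangent to the identity at [x] are controlled, but the
    covering is that of the whole stabilizer: near any [k0] the differential of
    [k] at [phi x] and at nearby points are close to the same operator, the
    differential of [k0], and the former is the identity. *)
Lemma tangent_to_id_uniformly_near_id phi x : atlas M phi -> chart_dom phi x ->
  compact (stabilizer act x) ->
  exists2 r : R, 0 < r & forall k, tangent_to_id phi x k ->
    near_id_on (in_charts phi phi (act k)) (phi x) r.
Proof.
move=> pA xd /compact_near_coveringP cov.
pose P (r : R) k := tangent_to_id phi x k ->
  near_id_on (in_charts phi phi (act k)) (phi x) r.
suff : \forall r \near 0^'+, stabilizer act x `<=` P r.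
  move=> near0; near (0 : R)^'+ => r; exists r => // k ktan.
  have [kx _] := ktan.
  by have := near near0 r; apply.
apply: cov => k0 k0x.
have [alpha aA kd] := atlas_cover k0.
pose F := act_charts alpha phi phi.
have [dF CF] := act_charts_smooth aA pA pA 1%N.
(* [eps] is chosen with [n * eps <= 1 / 2]; the successor covers [n = 0]. *)
pose eps : R := (n.+1%:R * 2)^-1.
have eps0 : 0 < eps by rewrite invr_gt0 mulr_gt0.
have : \forall z \near (alpha k0, phi x), act_charts_dom alpha phi phi z /\
    forall j : 'I_n, `|'D_(0, delta_mx 0 j) F (alpha k0, phi x) -
                       'D_(0, delta_mx 0 j) F z| < eps / 2.
  have S := near_act_charts_dom aA pA kd xd k0x.
  have C (j : 'I_n) : \forall z \near (alpha k0, phi x),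
      `|'D_(0, delta_mx 0 j) F (alpha k0, phi x) -
        'D_(0, delta_mx 0 j) F z| < eps / 2.
    have := CF (0, delta_mx 0 j) _ (nbhs_singleton S).
    by move/cvgrPdist_lt; apply; exact: divr_gt0.
  exact: filterS2 S (filter_forall _ C).
move=> /nbhs_ballP[/= r r0 rP].
have kr : \forall k \near k0,
    chart_dom alpha k /\ ball (alpha k0) r (alpha k).
  have ak := chart_continuous aA kd (near_ball (alpha k0) _ r0).
  exact: filterS2 (near_chart_dom aA kd) ak.
exists ([set k | chart_dom alpha k /\ ball (alpha k0) r (alpha k)],
        [set s | s < r]) => /=.
  by split => //; exact: nbhs_right_lt.
move=> [k s] /= [[kd' kr'] sr] [kx kD] u v us vs.
have FE : in_charts phi phi (act k) = (fun y => F (alpha k, y)).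
  by apply/funext => y; rewrite /F act_chartsE.
have inr y : ball (phi x) s y -> act_charts_dom alpha phi phi (alpha k, y) /\
    forall j : 'I_n, `|'D_(0, delta_mx 0 j) F (alpha k0, phi x) -
                       'D_(0, delta_mx 0 j) F (alpha k, y)| < eps / 2.
  by move=> /(le_ball (ltW sr)) yr; apply: rP; split.
have [_ Fx] : act_charts_dom alpha phi phi (alpha k, phi x) /\
    forall j : 'I_n, `|'D_(0, delta_mx 0 j) F (alpha k0, phi x) -
                       'D_(0, delta_mx 0 j) F (alpha k, phi x)| < eps / 2.
  by apply: rP; split => //; exact: ballxx.
apply: le_trans (near_id_on_ball (ltW eps0) _ _ us vs) _.
- move=> y /inr[/dF Fy _]; rewrite FE.
  by apply: (@differentiable_comp _ _ _ _ (fun y => (alpha k, y)) F).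
- move=> y j /inr[_ /(_ j) Fy]; rewrite -[X in _ - X]kD.
  rewrite FE !derive_pair_r [eps]splitr.
  rewrite -(subrKA ('D_(0, delta_mx 0 j) F (alpha k0, phi x))).
  apply: (le_trans (ler_normD _ _)); apply: lerD; last exact/ltW/Fx.
  by rewrite distrC ltW.
rewrite ler_wpM2r// /eps invfM mulrA ler_piMl// ler_pdivrMr// mul1r.
by rewrite ler_nat.
Unshelve. all: by end_near.
Qed.

(** The orbit of [y] under the powers of [h], read in the chart, is both bounded
    and, unless [h y = y], drifting; both facts come from the one estimate that
    holds for all powers of [h]. *)
Lemma tangent_to_id_locally_trivial phi x h : atlas M phi -> chart_dom phi x ->
  compact (stabilizer act x) -> tangent_to_id phi x h ->
  \forall y \near x, act h y = y.
Proof.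
move=> pA xd cx htan; have [hx _] := htan.
have [r r0 rP] := tangent_to_id_uniformly_near_id pA xd cx.
pose D y := chart_dom phi y /\ ball (phi x) r (phi y).
have nD : \forall y \near x, D y.
  have xr := chart_continuous pA xd (near_ball (phi x) _ r0).
  exact: filterS2 (near_chart_dom pA xd) xr.
have nDh : \forall y \near x, D (act h y).
  by apply: (@act_continuous h x D); rewrite hx.
apply: filterS2 nD nDh => y [yd yr] [hyd hyr].
rewrite -(chart_invK pA hyd) -[RHS](chart_invK pA yd); congr chart_inv.
apply/eqP; rewrite -subr_eq0; apply/eqP.
pose z m := phi (act (h ^+ m)%g y).
have locE k p : chart_dom phi p ->
    in_charts phi phi (act k) (phi p) = phi (act k p).
  by move=> pd; rewrite /in_charts /= chart_invK.
(* The points [h y] and [y] give the drift, the points [y] and [x] the bound. *)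
apply: (@bounded_drift_eq0 _ _ z (phi y) _ (2^-1 * `|phi y - phi x|)) => m;
  have mtan := tangent_to_idX m pA xd htan.
  have := rP _ mtan _ _ hyr yr; rewrite !locE// -actM.
  by rewrite /z expgSr.
have := rP _ mtan _ _ yr (ballxx _ r0); rewrite !locE//.
by have [-> _] := mtan; rewrite opprB addrA subrK.
Qed.

Lemma interior_fixed_derive psi h q w : atlas M psi -> chart_dom psi q ->
  interior [set y | act h y = y] q ->
  'D_w (in_charts psi psi (act h)) (psi q) = w.
Proof.
move=> qA qd Bq.
have E : \forall u \near psi q, in_charts psi psi (act h) u = id u.
  have := near_chart_inv qA qd Bq; apply: filterS2 (near_chart_im qA qd).
  by move=> u [ud uE] hu; rewrite /in_charts /= hu.
by rewrite (near_eq_derive _ E) derive_id.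
Qed.

(** The fixed point set of [h] is closed because [M] is Hausdorff. *)
Lemma closure_interior_fixed h p :
  closure (interior [set y | act h y = y]) p -> act h p = p.
Proof.
move=> Bp; apply: (@manifold_hausdorff R n M) => U V Up Vp.
have hU : nbhs p (act h @^-1` U) by exact: act_continuous.
have [q [/interior_subset hq [Uq Vq]]] := Bp _ (filterI hU Vp).
by exists q; split => //; rewrite -hq.
Qed.

(** The derivative of [h] in the chart is the identity at points of the interior
    accumulating at [p], and it is continuous at [p]. *)
Lemma closure_interior_fixed_tangent psi h p : atlas M psi -> chart_dom psi p ->
  closure (interior [set y | act h y = y]) p -> tangent_to_id psi p h.
Proof.
move=> qA pd Bp; have hp := closure_interior_fixed Bp; split=> // w.
have hpd : chart_dom psi (act h p) by rewrite hp.
pose g := fun u => 'D_w (in_charts psi psi (act h)) u.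
have cg : {for p, continuous (g \o psi)}.
  apply: continuous_comp; first exact: chart_continuous.
  exact: act_chart_derive_continuous.
apply: contrapT => gw.
have gw0 : 0 < `|g (psi p) - w|.
  by rewrite normr_gt0 subr_eq0; apply/eqP.
have near_lt : \forall q \near p, `|g (psi p) - g (psi q)| < `|g (psi p) - w|.
  by move/cvgrPdist_lt : cg => /(_ _ gw0).
have [q [Bq [qd]]] := Bp _ (filterI (near_chart_dom qA pd) near_lt).
by rewrite /g /= (interior_fixed_derive w qA qd Bq) ltxx.
Qed.

(** The interior of the fixed point set of [h] is closed because, by
    [closure_interior_fixed_tangent], the local result applies at every point
    of its closure; this is why compactness is assumed at all points. *)
Lemma tangent_to_id_trivial phi x h : connected [set: M] ->
  (forall y, compact (stabilizer act y)) ->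
  atlas M phi -> chart_dom phi x -> tangent_to_id phi x h ->
  forall y, act h y = y.
Proof.
move=> cM cst pA xd htan.
pose B := interior [set y | act h y = y].
suff BT : B = setT.
  by move=> y; have : B y by [rewrite BT]; exact: interior_subset.
apply: cM.
- by exists x; exact: (tangent_to_id_locally_trivial pA xd).
- by exists B; [exact: open_interior|rewrite setTI].
exists B; last by rewrite setTI.
move=> p Bp; have [psi qA pd] := atlas_cover p.
apply: (tangent_to_id_locally_trivial qA pd) => //.
exact: closure_interior_fixed_tangent.
Qed.

(** * Jets of the action at the base point *)

Lemma smooth_near_act x k : smooth_near x (act k).
Proof.
by exists setT; split=> //; [exact: openT|exact: act_smooth_on].
Qed.

(** The map itself must belong to its jet, which smoothness near [x] ensures. *)
Lemma jet_eq_same_jet m x h k : jet m x (act h) = jet m x (act k) ->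
  same_jet m x (act h) (act k).
Proof.
move=> E; suff : jet m x (act h) (act k) by case.
by rewrite E; split; [exact: smooth_near_act|split].
Qed.

Lemma jet_faithful1 e : connected [set: G] -> transitive_action act ->
  effective_action act -> compact (stabilizer act e) -> jet_faithful act e 1.
Proof.
move=> cG tr eff ce h k /[!inE] hx kx /jet_eq_same_jet [_ J].
have [phi pA ed] := atlas_cover e.
have kh : tangent_to_id phi e (k^-1 * h)%g.
  apply: tangent_to_id_quotient => // w.
  by apply: (J phi phi pA pA ed _ [:: w]) => //; rewrite hx.
have : (k^-1 * h)%g = 1%g.
  apply: eff; apply: (tangent_to_id_trivial _ _ pA ed kh).
    exact: transitive_connected.
  by move=> y; have [g <-] := tr e y; exact: compact_stabilizer_act.
by move=> /(congr1 (fun z => k * z)%g); rewrite mulVKg mulg1.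
Qed.

(** A 0-jet at [e] records only the value at [e], which is the same for all
    elements of the stabilizer. *)
Lemma jet_faithful0 e : jet_faithful act e 0 -> stabilizer act e = [set 1%g].
Proof.
move=> inj; apply/seteqP; split=> [h hx|_ ->]; last exact: act1.
apply: inj; rewrite ?inE//; first exact: act1.
have J (f g : M -> M) : f e = g e -> jet 0 e f `<=` jet 0 e g.
  move=> fg f' [sf [ff' _]]; split=> //; split; first by rewrite -fg.
  move=> phi psi pA qA ed gd vs; rewrite leqn0 => /nilP ->.
  by rewrite /= /in_charts /= chart_invK// -fg ff'.
have he : act h e = act 1%g e by rewrite act1.
by apply/seteqP; split; exact: J.
Qed.

End Action.

Theorem proposition23 (R : realType) (d n : nat)
    (G : lieGroupType R d) (M : smoothManifoldType R n)
    (act : G -> M -> M) (e : M)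
    (G_connected : connected [set: G])
    (act_smooth : smooth_action act)
    (act_transitive : transitive_action act)
    (act_effective : effective_action act)
    (H_compact : compact (stabilizer act e))
    (H_connected : connected (stabilizer act e))
    (H_nontrivial : stabilizer act e <> [set 1%g]) :
  action_order act e = 1%N.
Proof.
have F1 := jet_faithful1 act_smooth G_connected act_transitive act_effective
  H_compact.
have F0 : ~ jet_faithful act e 0.
  by move=> /(jet_faithful0 act_smooth) /H_nontrivial.
apply: xget_unique => [|i [Fi imin]].
  by split=> // -[/F0|].
apply/eqP; rewrite eqn_leq imin//=.
by case: i Fi {imin} => [/F0|].
Qed.
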